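(* Let $\mathbf{A}\neq\mathbf{Ind}$ be an epireflective subcategory of $\mathbf{Top}$ with $I_2\in\mathbf{A}$, and let $\mathbf{C}$ be an AD-class in $\mathbf{A}$. Then $\mathbf{C}$ is hereditary if and only if $R_0\mathbf{C}=\mathbf{C}\cap\mathbf{Top}_0$ is hereditary.
   Context: $\mathbf{Top}$ is the category of topological spaces and continuous maps. All subcategories are full and isomorphism-closed (so they are identified with classes of spaces), and every subcategory of $\mathbf{Top}$ is assumed to contain at least one space with at least two points. A subcategory of $\mathbf{Top}$ is epireflective in $\mathbf{Top}$ if and only if it is closed under topological products and subspaces. $I_2$ is the two-point indiscrete space; $\mathbf{Ind}$ is the subcategory of all indiscrete spaces; $\mathbf{Top}_0$ is the subcategory of all $T_0$-spaces. A class $\mathbf{C}\subseteq\mathbf{A}$ is an AD-class in $\mathbf{A}$ if it is additive (closed under topological sums, i.e. disjoint unions) and divisible in $\mathbf{A}$ (if $q\colon X\to Y$ is a quotient map with $X\in\mathbf{C}$ and $Y\in\mathbf{A}$, then $Y\in\mathbf{C}$). A class is hereditary if it is closed under subspaces. $R_0$ denotes the $T_0$-reflector: $R_0X$ is the quotient space of $X$ by the equivalence relation $x\sim y\iff\overline{\{x\}}=\overline{\{y\}}$. $R_0\mathbf{C}=\{R_0C: C\in\mathbf{C}\}$ (up to homeomorphism); for $\mathbf{C}$ as in the claim, the classes $R_0\mathbf{C}$ and $\mathbf{C}\cap\mathbf{Top}_0$ coincide. *)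

(* Defs.v *)
From HB Require Import structures.
From mathcomp Require Import all_boot all_order all_algebra.
From mathcomp Require Import all_classical.
From mathcomp Require Import topology.

Set Implicit Arguments.
Unset Strict Implicit.
Unset Printing Implicit Defensive.

Local Open Scope classical_set_scope.
Local Open Scope quotient_scope.

Definition indiscrete (T : Type) : Type := T.

Section Indiscrete.
Variable T : choiceType.

Definition indiscrete_open (U : set (indiscrete T)) : Prop :=
  U = set0 \/ U = setT.

Let indiscrete_openT : indiscrete_open setT.
Proof. by right. Qed.

Let indiscrete_openI : setI_closed indiscrete_open.
Proof.
move=> U V [->|->]; first by left; rewrite set0I.
by rewrite setTI.
Qed.

Let indiscrete_open_bigcup (I : Type) (f : I -> set (indiscrete T)) :
  (forall i, indiscrete_open (f i)) -> indiscrete_open (\bigcup_i f i).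
Proof.
move=> fop; have [[i fi]|nf] := pselect (exists i, f i = setT).
  by right; apply/seteqP; split=> // x _; exists i => //; rewrite fi.
left; apply/seteqP; split=> // x [i _ fix_].
by case: (fop i) => fi; [rewrite fi in fix_|case: nf; exists i].
Qed.

HB.instance Definition _ := Choice.copy (indiscrete T) T.
HB.instance Definition _ := isOpenTopological.Build (indiscrete T)
  indiscrete_openT indiscrete_openI indiscrete_open_bigcup.

End Indiscrete.

Definition I2 : topologicalType := indiscrete bool.

Definition homeomorphic (X Y : topologicalType) : Prop :=
  exists (f : X -> Y) (g : Y -> X),
    [/\ continuous f, continuous g, cancel f g & cancel g f].

(* The categorical epimorphisms of Top: no surjectivity is built in. *)
Definition epimorphism (X Y : topologicalType) (f : X -> Y) : Prop :=
  continuous f /\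
  forall (Z : topologicalType) (g h : Y -> Z),
    continuous g -> continuous h -> g \o f = h \o f -> g = h.

Definition quotient_map (X Y : topologicalType) (q : X -> Y) : Prop :=
  (forall y, exists x, q x = y) /\
  (forall U : set Y, open U <-> open (q @^-1` U)).

(* A full isomorphism-closed subcategory of Top is identified with its class
   of objects. *)
Record subcategory (A : topologicalType -> Prop) : Prop := {
  iso_closed : forall X Y : topologicalType, homeomorphic X Y -> A X -> A Y;
  has_two_points : exists X : topologicalType, A X /\ exists x y : X, x <> y }.

Definition same_class (A B : topologicalType -> Prop) : Prop :=
  forall X, A X <-> B X.

Definition epireflective (A : topologicalType -> Prop) : Prop :=
  forall X : topologicalType, exists (RX : topologicalType) (r : X -> RX),
    [/\ A RX, epimorphism r &
        forall Y : topologicalType, A Y -> forall f : X -> Y, continuous f ->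
          exists! g : RX -> Y, continuous g /\ g \o r = f].

(* [set_type S] carries the subspace topology (the topology of [subspace S]
   lives on the whole of [X]). *)
Definition hereditary (C : topologicalType -> Prop) : Prop :=
  forall (X : topologicalType) (S : set X), C X -> C (set_type S).

(* Indexing by a choiceType, as the library's topology on {i : I & X i}
   requires, is no restriction: classically every type is one. *)
Definition additive (C : topologicalType -> Prop) : Prop :=
  forall (I : choiceType) (X : I -> topologicalType),
    (forall i, C (X i)) -> C {i : I & X i}.

Definition divisible_in (A C : topologicalType -> Prop) : Prop :=
  forall (X Y : topologicalType) (q : X -> Y),
    quotient_map q -> C X -> A Y -> C Y.

Definition AD_class (A C : topologicalType -> Prop) : Prop :=
  [/\ forall X, C X -> A X, additive C & divisible_in A C].

Definition Ind (X : topologicalType) : Prop :=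
  forall U : set X, open U -> U = set0 \/ U = setT.

Definition Top0 (X : topologicalType) : Prop := kolmogorov_space X.

Section T0Reflector.
Variable X : topologicalType.

Definition same_closure : rel X :=
  fun x y => `[< closure [set x] = closure [set y] >].

Let same_closure_refl : reflexive same_closure.
Proof. by move=> x; apply/asboolP. Qed.

Let same_closure_sym : symmetric same_closure.
Proof. by move=> x y; apply/asboolP/asboolP. Qed.

Let same_closure_trans : transitive same_closure.
Proof. by move=> y x z /asboolP xy /asboolP yz; apply/asboolP; rewrite xy. Qed.

Canonical same_closure_equiv :=
  EquivRel same_closure same_closure_refl same_closure_sym same_closure_trans.

Definition R0 : topologicalType :=
  quotient_topology {eq_quot same_closure_equiv}.

End T0Reflector.

Definition R0_class (C : topologicalType -> Prop) (Y : topologicalType) : Prop :=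
  exists X : topologicalType, C X /\ homeomorphic Y (R0 X).

(* Main.v *)
Require Import Defs.
From mathcomp Require Import all_boot all_classical topology.

(** Only one implication is not formal.  Let [R0_class C] be hereditary, [X] in
    [C] and [S] a subset of [X].  If every space of [C] is discrete, then [X] is
    T0 and there is nothing to do.  Otherwise [I2] is in [C]: for [U] not open
    in [X], the subset [U + ~U] of the sum [X + X] is neither open nor closed,
    so its indicator function is a quotient map onto [I2].  The image [T] of
    [S] in [R0 X] lies in [C], and [S] is a quotient of the sum of [T] (mapped
    to [S] by a section) and of one copy of [I2] for each pair of topologically
    indistinguishable points of [S]. *)

Set Implicit Arguments.
Unset Strict Implicit.
Unset Printing Implicit Defensive.

Local Open Scope classical_set_scope.
Local Open Scope quotient_scope.

(** * Indistinguishable points, T0-spaces and embeddings *)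

Definition indistinguishable (X : topologicalType) (x y : X) : Prop :=
  forall U : set X, open U -> (U x <-> U y).

(** Stated for maps rather than subsets, so as to cover subspace inclusions, homeomorphisms and
    sections such as [of_R0]. *)
Definition embedding (X Y : topologicalType) (f : X -> Y) : Prop :=
  injective f /\
  forall U : set X, open U <-> exists2 V : set Y, open V & f @^-1` V = U.

(** A point [b] lies in the closure of [a] exactly when every open set containing [b] contains
    [a]. *)
Lemma same_closureP (X : topologicalType) (x y : X) :
  reflect (indistinguishable x y) (same_closure x y).
Proof.
have clP (a b : X) : closure [set a] b <-> forall U, open U -> U b -> U a.
  split=> [clab U oU Ub|ab B /nbhs_interior].
    by have [_ [->]] := clab U (open_nbhs_nbhs (conj oU Ub)).
  move=> /nbhs_singleton Bb; exists a; split=> //.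
  by apply: interior_subset; apply: ab Bb; exact: open_interior.
apply: (iffP (asboolP _)) => [xy U oU|xy].
  split=> Ua.
    have /clP : closure [set y] x by rewrite -xy; exact/subset_closure.
    exact.
  have /clP : closure [set x] y by rewrite xy; exact/subset_closure.
  exact.
apply/seteqP; split=> z /clP h; apply/clP => U oU Uz.
  by apply/(xy _ oU)/(h _ oU).
by apply/(xy _ oU)/(h _ oU).
Qed.

Lemma Top0P (X : topologicalType) :
  Top0 X <-> forall x y : X, indistinguishable x y -> x = y.
Proof.
split=> [T0X x y xy|T0X x y /eqP xNy].
  apply: contrapT => xNy; have /T0X[B] : x != y by exact/eqP.
  rewrite !inE => -[[/nbhs_interior/nbhs_singleton Bx By]|].
    by apply: By; apply: interior_subset; apply/(xy _ (open_interior B)).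
  move=> [/nbhs_interior/nbhs_singleton Bx By].
  by apply: By; apply: interior_subset; apply/(xy _ (open_interior B)).
have [U /not_implyP[oU UxyN]] : exists U : set X, ~ (open U -> (U x <-> U y)).
  by apply/existsNP => /T0X.
have [Ux|Ux] := pselect (U x); have [Uy|Uy] := pselect (U y).
- by case: UxyN.
- by exists U; left; rewrite !inE; split=> //; exact: open_nbhs_nbhs.
- by exists U; right; rewrite !inE; split=> //; exact: open_nbhs_nbhs.
- by case: UxyN.
Qed.

Lemma open_set_type (X : topologicalType) (S : set X) (U : set (set_type S)) :
  open U <-> exists2 V : set X, open V & set_val @^-1` V = U.
Proof. by []. Qed.

Lemma embedding_set_val (X : topologicalType) (S : set X) :
  embedding (set_val : set_type S -> X).
Proof. by split; [exact: val_inj | exact: open_set_type]. Qed.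

Lemma Top0_embedding (X Y : topologicalType) (f : X -> Y) :
  embedding f -> Top0 Y -> Top0 X.
Proof.
move=> [finj fopen] /Top0P T0Y; apply/Top0P => x y xy; apply/finj/T0Y => V oV.
by apply: (xy (f @^-1` V)); apply/fopen; exists V.
Qed.

Lemma homeomorphic_sym (X Y : topologicalType) :
  homeomorphic X Y -> homeomorphic Y X.
Proof. by move=> [f [g [cf cg fK gK]]]; exists g, f. Qed.

Lemma homeomorphic_embedding (X Y : topologicalType) :
  homeomorphic X Y -> exists f : X -> Y, embedding f.
Proof.
move=> [f [g [/continuousP cf /continuousP cg fK gK]]]; exists f.
split=> [|U]; first exact: can_inj fK.
split=> [/cg oU|[V /cf oV <-//]]; exists (g @^-1` U) => //.
by rewrite -comp_preimage; apply/seteqP; split=> x; rewrite /= fK.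
Qed.

(** * Epireflective subcategories are closed under subspaces *)

Lemma continuous_to_I2 (X : topologicalType) (f : X -> I2) : continuous f.
Proof.
apply/continuousP => _ [->|->]; first by rewrite preimage_set0; exact: open0.
by rewrite preimage_setT; exact: openT.
Qed.

(** The indicator of the image and the constant [true], both continuous as maps into [I2], agree on
    the image of [f]. *)
Lemma epimorphism_surjective (X Y : topologicalType) (f : X -> Y) :
  epimorphism f -> forall y, exists x, f x = y.
Proof.
move=> [_ epif] y; pose g (z : Y) : I2 := `[< exists x, f x = z >].
have gT : g = (fun=> true : I2).
  apply: epif; [exact: continuous_to_I2 | exact: continuous_to_I2 |].
  by apply/funext => x; apply/asboolP; exists x.
by apply/asboolP; rewrite -/(g y) gT.
Qed.

(** The embedding [f] factors through the reflection [r], so the surjection [r] is also injective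
    and its inverse is continuous: [X] is homeomorphic to [RX]. *)
Lemma epireflective_embedding (A : topologicalType -> Prop)
    (X Y : topologicalType) (f : X -> Y) :
  subcategory A -> epireflective A -> embedding f -> A Y -> A X.
Proof.
move=> subA epiA [finj fopen] AY.
have cf : continuous f by apply/continuousP => V oV; apply/fopen; exists V.
have [RX [r [ARX epir /(_ Y AY f cf)]]] := epiA X.
move=> [g [[/continuousP cg gr] _]].
have grE x : g (r x) = f x by rewrite -gr.
have [h rh] := choice (epimorphism_surjective epir).
apply: (iso_closed subA _ ARX); exists h, r; split=> //; last first.
- by move=> x; apply: finj; rewrite -!grE rh.
- by case: epir.
apply/continuousP => U /fopen[V /cg oV <-].
rewrite (_ : h @^-1` _ = g @^-1` V)//.
by apply/seteqP; split=> z; rewrite /= -grE rh.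
Qed.

(** * The T0-reflection as both a quotient and a subspace *)

Definition to_R0 (X : topologicalType) (x : X) : R0 X :=
  \pi_({eq_quot same_closure_equiv X}) x.

Definition of_R0 (X : topologicalType) (z : R0 X) : X :=
  repr (z : {eq_quot same_closure_equiv X}).

Lemma of_R0K (X : topologicalType) : cancel (@of_R0 X) (@to_R0 X).
Proof. by move=> z; rewrite /to_R0 /of_R0 reprK. Qed.

Lemma to_R0P (X : topologicalType) (x y : X) :
  to_R0 x = to_R0 y <-> indistinguishable x y.
Proof.
split=> [|/same_closureP xy]; last exact/eqmodP.
by move=> /eqmodP /same_closureP.
Qed.

Lemma open_R0 (X : topologicalType) (W : set (R0 X)) :
  open W <-> open (@to_R0 X @^-1` W).
Proof. by []. Qed.

(* Open sets are unions of indistinguishability classes, so they correspond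
   bijectively to those of the quotient. *)
Lemma preimage_of_R0 (X : topologicalType) (U : set X) :
  open U -> @to_R0 X @^-1` (@of_R0 X @^-1` U) = U.
Proof.
move=> oU; apply/seteqP.
have xE (x : X) : indistinguishable (of_R0 (to_R0 x)) x.
  by apply/to_R0P; rewrite of_R0K.
by split=> x /=; have [] := xE x U oU.
Qed.

Lemma embedding_of_R0 (X : topologicalType) : embedding (@of_R0 X).
Proof.
split=> [|W]; first exact: can_inj (@of_R0K X).
split=> [oW|[V oV <-]]; last by apply/open_R0; rewrite preimage_of_R0.
exists (@to_R0 X @^-1` W); first exact/open_R0.
by apply/seteqP; split=> z; rewrite /= of_R0K.
Qed.

Lemma Top0_R0 (X : topologicalType) : Top0 (R0 X).
Proof.
apply/Top0P => z w zw; rewrite -[z]of_R0K -[w]of_R0K; apply/to_R0P => U oU.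
by apply: (zw (@of_R0 X @^-1` U)); apply/open_R0; rewrite preimage_of_R0.
Qed.

Lemma quotient_map_to_R0 (X : topologicalType) : quotient_map (@to_R0 X).
Proof.
split=> [z|U]; last exact: open_R0.
by exists (of_R0 z); exact: of_R0K.
Qed.

Lemma homeomorphic_R0 (X : topologicalType) : Top0 X -> homeomorphic X (R0 X).
Proof.
move=> /Top0P T0X; exists (@to_R0 X), (@of_R0 X); split.
- by apply/continuousP => W /open_R0.
- by apply/continuousP => U oU; apply/open_R0; rewrite preimage_of_R0.
- by move=> x; apply/T0X/to_R0P; rewrite of_R0K.
- exact: of_R0K.
Qed.

(** [R0 X] is a quotient of [X], and it lies in [A] because a choice of representatives embeds it in
    [X]; so divisibility in [A] applies. *)
Lemma R0_class_Top0 (A C : topologicalType -> Prop) :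
  subcategory A -> epireflective A -> subcategory C -> AD_class A C ->
  same_class (R0_class C) (fun X => C X /\ Top0 X).
Proof.
move=> subA epiA subC [CA _ divC] Y; split=> [[X [CX YX]]|[CY T0Y]]; last first.
  by exists Y; split=> //; exact: homeomorphic_R0.
split.
  apply: (iso_closed subC (homeomorphic_sym YX)).
  apply: (divC _ _ _ (@quotient_map_to_R0 X) CX).
  exact: epireflective_embedding (@embedding_of_R0 X) (CA _ CX).
have [f ef] := homeomorphic_embedding YX.
exact: Top0_embedding ef (@Top0_R0 X).
Qed.

(** The singletons of [I2] pull back to [N] and its complement, neither of which is open; neither is
    empty, since otherwise [N] would be open and closed. *)
Lemma quotient_map_I2 (X : topologicalType) (N : set X) :
  ~ open N -> ~ closed N -> quotient_map (fun x => `[< N x >] : I2).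
Proof.
move=> oN cN; set q := (fun x => _).
have qT : q @^-1` [set true : I2] = N.
  by apply/seteqP; split=> x; [move/asboolP | exact: asboolT].
have qF : q @^-1` [set false : I2] = ~` N.
  by apply/seteqP; split=> x; [move/negbT/asboolPn | exact: asboolF].
split=> [b|U]; last first.
  split=> [|oU]; first by move/continuousP : (@continuous_to_I2 X q); exact.
  have [Ut|Ut] := pselect (U true); have [Uf|Uf] := pselect (U false).
  - by right; apply/seteqP; split=> // -[].
  - exfalso; apply: oN; rewrite -qT (_ : [set true : I2] = U)//.
    by apply/seteqP; split=> [_ ->|[]].
  - exfalso; apply/cN; rewrite -openC -qF (_ : [set false : I2] = U)//.
    by apply/seteqP; split=> [_ ->|[]].
  - by left; apply/seteqP; split=> // -[].
apply: contrapT => /forallNP nq.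
have qb0 : q @^-1` [set b] = set0 by apply/seteqP; split=> x //= /nq.
case: b {nq} qb0; rewrite ?qT ?qF => N0.
  by apply: oN; rewrite N0; exact: open0.
by apply: cN; rewrite -openC N0; exact: open0.
Qed.

Lemma AD_class_I2 (A C : topologicalType -> Prop) (X : topologicalType)
    (U : set X) :
  A I2 -> AD_class A C -> C X -> ~ open U -> C I2.
Proof.
move=> AI2 [_ addC divC] CX oU.
pose N : set {b : bool & X} :=
  fun p => if projT1 p then U (projT2 p) else ~ U (projT2 p).
have CXX : C {b : bool & X} by exact: (addC bool (fun=> X)).
apply: (divC _ _ _ (@quotient_map_I2 _ N _ _) CXX AI2) => [/sigT_openP|].
  by move=> /(_ true).
(* On the [false] summand, the complement of [N] is the double complement of [U]. *)
rewrite -openC => /sigT_openP/(_ false).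
rewrite (_ : _ @^-1` _ = U)//.
by apply/seteqP; split=> x /=; [exact: contrapT | move=> Ux; apply].
Qed.

(* The point [existT _ None t] is sent to [s t]; the copy of [I2] indexed by
   [Some (x, y)] is sent onto [{x, y}], or onto [{x}] when [x] and [y] are
   distinguishable. *)
Lemma AD_class_section (A C : topologicalType -> Prop)
    (S T : topologicalType) (p : S -> T) (s : T -> S) :
  AD_class A C -> C I2 -> C T -> A S -> continuous p -> continuous s ->
  (forall x, indistinguishable (s (p x)) x) -> C S.
Proof.
move=> [_ addC divC] CI2 CT AS /continuousP cp /continuousP cs spx.
pose F (i : option (S * S)) : topologicalType := if i is Some _ then I2 else T.
pose q (u : {i : option (S * S) & F i}) : S :=
  match u with
  | existT None t => s t
  | existT (Some (x, y)) b =>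
      if b && `[< indistinguishable x y >] then y else x
  end.
have CF : C {i & F i} by apply: addC => -[].
apply: (divC _ _ q _ CF AS); split=> [x|U].
  by exists (existT F (Some (x, x)) false).
split=> [oU|/sigT_openP oqU].
  apply/sigT_openP => -[[x y]|]; last exact: cs.
  have Uq b : U (q (existT F (Some (x, y)) b)) <-> U x.
    by rewrite /q; case: ifP => // /andP[_ /asboolP xy]; split=> /(xy _ oU).
  have [Ux|Ux] := pselect (U x); [right|left]; apply/seteqP.
    by split=> b // _; exact/Uq.
  by split=> b // /Uq.
(* The copy of [I2] at [(x, y)] forces [U] to contain both points or neither. *)
have satU x y : indistinguishable x y -> U x -> U y.
  move=> xy Ux; have [U0|UT] : open (existT F (Some (x, y)) @^-1` (q @^-1` U)).
  - exact: oqU.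
  - by have : set0 (false : I2) by rewrite -U0.
  - have : [set: I2] true by [].
    by rewrite -UT /= /q asboolT.
(* [s (p x)] is indistinguishable from [x], so a saturated [U] is recovered from its trace on
   [T]. *)
rewrite (_ : U = p @^-1` (s @^-1` U)); first exact/cp/(oqU None).
apply/seteqP; split=> x /=; apply: satU; last exact: spx.
by move=> V oV; split=> /(spx _ _ oV).
Qed.

Lemma hereditary_of_R0_class (A C : topologicalType -> Prop) :
  subcategory A -> epireflective A -> A I2 -> subcategory C -> AD_class A C ->
  hereditary (R0_class C) -> hereditary C.
Proof.
move=> subA epiA AI2 subC ADC herR X S CX.
have R0C := R0_class_Top0 subA epiA subC ADC.
have CTop0 (Y : topologicalType) (B : set Y) : C Y -> Top0 Y -> C (set_type B).
  by move=> CY T0Y; have /R0C/(herR _ B)/R0C[] := conj CY T0Y.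
have [discX|/existsNP[U oU]] := pselect (forall U : set X, open U).
  apply: CTop0 => //; apply/Top0P => x y /(_ [set x] (discX _))[+ _].
  by move=> /(_ erefl).
have CI2 : C I2 by exact: AD_class_I2 ADC CX oU.
have AX : A X by case: ADC => + _ _; exact.
have AS : A (set_type S).
  exact: epireflective_embedding (embedding_set_val S) AX.
pose T := set_type (@to_R0 X @` S).
have CT : C T.
  have /R0C[CR T0R] : R0_class C (R0 X).
    by exists X; split=> //; exists id, id; split=> // ?; exact: cvg_id.
  exact: CTop0.
pose p (x : set_type S) : T :=
  exist _ (to_R0 (set_val x)) (mem_set (imageP _ (set_valP x))).
have /choice[s ps] (t : T) : exists x, p x = t.
  by have [x Sx xt] := set_valP t; exists (exist _ x (mem_set Sx));
  exact: val_inj.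
have indist (x y : set_type S) : p x = p y -> indistinguishable x y.
  move=> /(congr1 val) /to_R0P xy V /open_set_type[W oW <-].
  exact: xy.
apply: (@AD_class_section A C (set_type S) T p s) => //.
- by apply/continuousP => V /open_set_type[W oW <-]; exists (@to_R0 X @^-1` W).
(* The arbitrary choice of [s] does no harm: an open [W] cannot tell [s t] from the representative
   chosen by [of_R0]. *)
- apply/continuousP => V /open_set_type[W oW <-].
  exists (@of_R0 X @^-1` W); first by apply/open_R0; rewrite preimage_of_R0.
  apply/funext => t; rewrite /= -[in LHS](ps t).
  exact: (congr1 (fun V : set X => V (set_val (s t))) (preimage_of_R0 oW)).
- by move=> x; apply: indist; rewrite ps.
Qed.

Theorem theorem5p4 (A C : topologicalType -> Prop)
  (A_subcat : subcategory A) (A_epi : epireflective A)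
  (A_neq_Ind : ~ same_class A Ind) (A_I2 : A I2)
  (C_subcat : subcategory C) (C_AD : AD_class A C) :
  same_class (R0_class C) (fun X => C X /\ Top0 X) /\
  (hereditary C <-> hereditary (R0_class C)).
Proof.
have R0C := R0_class_Top0 A_subcat A_epi C_subcat C_AD.
split=> //; split=> [herC X S /R0C[CX T0X]|].
  apply/R0C; split; first exact: herC.
  exact: Top0_embedding (embedding_set_val S) T0X.
exact: (hereditary_of_R0_class A_subcat).
Qed.
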